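(* Let $s$ be an arbitrary string of length $n$ over the alphabet $[\sigma]$, where $\sigma\le n$. Any algorithm solving $\mathrm{rank}$ or $\mathrm{select}$ queries on $s$ using at most $t$ character probes (i.e. calls to $\mathrm{access}$), where $1\le t\le n/2$, requires a succinct index with $r=\Omega\big(\frac{n\log t}{t}\big)$ bits of redundancy.
   Context: $[\sigma]=\{0,\dots,\sigma-1\}$, $\sigma\ge2$; logarithms are base 2. The string $s$ is read-only and can be read only through $\mathrm{access}(i)$, returning $s[i]$; each call is a probe. $\mathrm{select}(c,j)$ returns the position of the $j$th occurrence of $c$ in $s$ (or $-1$); $\mathrm{rank}(c,p)$ returns the number of occurrences of $c$ in $s[0,p-1]$. A succinct index is auxiliary information of $r$ bits (not counting the space for $s$) computed from $s$ in preprocessing; the query algorithm reads the index and accesses $s$ only by probes, at most $t$ per query. The redundancy $r$ is the worst case over all strings of length $n$. *)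

(* Defs.v *)
From HB Require Import structures.
From mathcomp Require Import all_boot all_order all_algebra.
From mathcomp Require Import reals exp.

Set Implicit Arguments.
Unset Strict Implicit.
Unset Printing Implicit Defensive.

Import Order.TTheory GRing.Theory Num.Theory.
Local Open Scope ring_scope.

Definition log2 (R : realType) (x : R) : R := ln x / ln 2.

Definition string (n sigma : nat) : Type := n.-tuple 'I_sigma.

Definition access (n sigma : nat) (s : string n sigma) (i : 'I_n) : 'I_sigma :=
  tnth s i.

Definition rank (n sigma : nat) (s : string n sigma) (q : 'I_sigma * nat) : nat :=
  count_mem q.1 (take q.2 s).

Definition rank_query (n sigma : nat) (q : 'I_sigma * nat) : Prop :=
  (q.2 <= n)%N.

(* [enum 'I_n] is increasing, so positions are listed from left to right. *)
Definition occurrences (n sigma : nat) (s : string n sigma) (c : 'I_sigma) :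
    seq int :=
  [seq Posz i | i : 'I_n <- enum 'I_n & access s i == c].

(* Occurrences are numbered from 1; the value at [q.2 = 0] is irrelevant, as
   [select_query] excludes it. *)
Definition select (n sigma : nat) (s : string n sigma) (q : 'I_sigma * nat) : int :=
  nth (-1) (occurrences s q.1) q.2.-1.

Definition select_query (sigma : nat) (q : 'I_sigma * nat) : Prop :=
  (0 < q.2)%N.

(* Adaptive probing: each probe may depend on the results of all earlier ones.
   Computation between probes is free, so this covers every deterministic
   algorithm whose access to the string is through [access] only. *)
Inductive probe_tree (n sigma : nat) (A : Type) : Type :=
| Answer of A
| Probe of 'I_n & ('I_sigma -> probe_tree n sigma A).

Fixpoint run (n sigma : nat) (A : Type) (T : probe_tree n sigma A)
    (s : string n sigma) : A :=
  match T with
  | Answer a => a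
  | Probe i k => run (k (access s i)) s
  end.

Fixpoint probes (n sigma : nat) (A : Type) (T : probe_tree n sigma A)
    (s : string n sigma) : nat :=
  match T with
  | Answer _ => 0
  | Probe i k => (probes (k (access s i)) s).+1
  end.

(* [index s] is computed from [s] in preprocessing; the query algorithm [alg]
   sees the whole index and the query, and nothing else of [s] but its probes. *)
Definition solves (n sigma : nat) (Q A : Type) (valid : Q -> Prop)
    (f : string n sigma -> Q -> A) (index : string n sigma -> seq bool)
    (alg : seq bool -> Q -> probe_tree n sigma A) (t : nat) : Prop :=
  forall (s : string n sigma) (q : Q), valid q ->
    run (alg (index s) q) s = f s q /\ (probes (alg (index s) q) s <= t)%N.

Definition solves_rank (n sigma : nat) (index : string n sigma -> seq bool)
    (alg : seq bool -> 'I_sigma * nat -> probe_tree n sigma nat) (t : nat) : Prop :=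
  solves (@rank_query n sigma) (@rank n sigma) index alg t.

Definition solves_select (n sigma : nat) (index : string n sigma -> seq bool)
    (alg : seq bool -> 'I_sigma * nat -> probe_tree n sigma int) (t : nat) : Prop :=
  solves (@select_query sigma) (@select n sigma) index alg t.

Definition redundancy (n sigma : nat) (index : string n sigma -> seq bool) : nat :=
  (\max_(s : n.-tuple 'I_sigma) size (index s))%N.

(* Main.v *)
(** It suffices to look at strings over two letters c0, c1 cut into m blocks of
    width W: in each block the first 2v positions are free, and the remaining
    more than v positions hold c1. If every block has at least v letters c0,
    one rank query at the end of a block, or one select query whose answer is
    forced to fall in the padding of the block, gives the number of c0 in the
    block once the earlier counts are known. Asking m such queries is a probe
    tree of depth at most m t whose leaf determines all the counts. At a leaf,
    a block with N unprobed free positions can be completed in at most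
    'C(N, k) <= 2^N / sqrt N ways, so for a fixed index only a fraction about
    t^(- m / 4) of the strings is possible. As there are at most 4^r indexes,
    r is of order m log t. For n >= 100 t one takes m about n / (100 t); for
    smaller n a single block suffices. *)
Require Import Defs.
From HB Require Import structures.
From mathcomp Require Import all_boot all_order all_algebra.
From mathcomp Require Import reals exp.
From mathcomp Require Import zify.
Import Order.TTheory GRing.Theory Num.Theory.

Set Implicit Arguments.
Unset Strict Implicit.
Unset Printing Implicit Defensive.

Local Notation blocks m L := {ffun 'I_m -> {set 'I_L}}.

(** * Bounds on binomial coefficients *)

Lemma bin_leS n k : k < n./2 -> 'C(n, k) <= 'C(n, k.+1).
Proof.
move=> kn; have := mul_bin_left n k.
rewrite -(leq_pmul2l (ltn0Sn k)) => ->.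
by apply: leq_mul => //; lia.
Qed.

Lemma bin_le_half n k : 'C(n, k) <= 'C(n, n./2).
Proof.
have below j : j <= n./2 -> 'C(n, j) <= 'C(n, n./2).
  move=> /subnKC; elim: (n./2 - j) {-2}j => [|d IHd] i; first by rewrite addn0 => ->.
  move=> eq_half; apply: leq_trans (IHd i.+1 _); last by rewrite addSnnS.
  by apply: bin_leS; rewrite -eq_half -addSnnS leq_addr.
case: (leqP k n./2) => [/below //|half_k].
case: (leqP k n) => [kn|/bin_small-> //].
by rewrite -bin_sub //; apply: below; lia.
Qed.

Lemma central_bin_rec k : k.+1 * 'C(k.+1.*2, k.+1) = (k.*2.+1).*2 * 'C(k.*2, k).
Proof.
rewrite doubleS -mul_bin_diag /= -[in LHS]bin_sub; last by lia.
have -> : k.*2.+1 - k = k.+1 by lia.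
have := mul_bin_diag k.*2.+1 k => /= e.
by rewrite -doubleS -!doubleMl e.
Qed.

(** Induction on [k]: by [central_bin_rec] the left side grows by the factor
    [4 (2k+1) (2k+3) / (k+1)^2], which is below 16 because [(2k+1) (2k+3) = (2k+2)^2 - 1]. *)
Lemma central_bin_sq_le k : 'C(k.*2, k) ^ 2 * k.*2.+1 <= 4 ^ k.*2.
Proof.
elim: k => [|k IHk]; first by rewrite bin0.
have := central_bin_rec k.
set c := 'C(k.*2, k) in IHk *; set c' := 'C(_, _) => e.
rewrite -(leq_pmul2l (_ : 0 < k.+1 ^ 2)) ?expn_gt0 //.
rewrite mulnA -expnMn e !doubleS.
have le4 : 4 * (k.*2.+1 * k.*2.+3) <= k.+1 ^ 2 * 4 ^ 2 by lia.
apply: leq_trans (_ : (4 * (k.*2.+1 * k.*2.+3)) * 4 ^ k.*2 <= _); last first.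
  rewrite -[k.*2.+2 in X in _ <= X]addn2 expnD [4 ^ k.*2 * _]mulnC [leqRHS]mulnA.
  by rewrite leq_mul2r le4 orbT.
apply: leq_trans (leq_mul (leqnn _) IHk).
by rewrite -muln2 !expnS expn0; lia.
Qed.

Lemma bin_sq_le n k : 'C(n, k) ^ 2 * n <= 4 ^ n.
Proof.
apply: (@leq_trans ('C(n, n./2) ^ 2 * n)).
  by rewrite leq_mul2r leq_exp2r ?bin_le_half ?orbT.
move: (odd n) n./2 (odd_double_half n) => b m <-; case: b; last first.
  by apply: leq_trans (central_bin_sq_le m); rewrite leq_mul2l leqnSn orbT.
rewrite add1n.
have := central_bin_sq_le m.+1.
(* An odd row is half of the next central coefficient, so the even case at [m.+1] applies. *)
have -> : 'C(m.+1.*2, m.+1) = 'C(m.*2.+1, m) * 2.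
  rewrite doubleS binS -[in X in X + _](bin_sub (_ : m.+1 <= _)); last by lia.
  have -> : m.*2.+1 - m.+1 = m by lia.
  by lia.
rewrite doubleS [4 ^ m.*2.+2]expnS; set x := 'C(_, _).
rewrite !expnS expn0; nia.
Qed.

(** The square root of [bin_sq_le], with the gain rounded to a power of 2 to stay in [nat]. *)
Lemma bin_mul_expn2_le e n k : 4 ^ e <= n -> 'C(n, k) * 2 ^ e <= 2 ^ n.
Proof.
move=> en; rewrite -(@leq_exp2r _ _ 2) // expnMn -!expnM ![_ * 2]mulnC !expnM.
by apply: leq_trans (bin_sq_le n k); rewrite leq_mul2l en orbT.
Qed.

Lemma bin_le_expn2 n k : 'C(n, k) <= 2 ^ n.
Proof.
case: (leqP k n) => [kn|/bin_small-> //].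
rewrite -[2]/(1 + 1) expnDn.
rewrite (bigD1 (Ordinal (kn : k < n.+1))) //= !exp1n !muln1; exact: leq_addr.
Qed.

(** * Composition of probe trees *)

Fixpoint bind (n sigma : nat) (A B : Type) (T : probe_tree n sigma A)
    (f : A -> probe_tree n sigma B) : probe_tree n sigma B :=
  match T with
  | Answer a => f a
  | Probe i k => Probe i (fun c => bind (k c) f)
  end.

Lemma run_bind n sigma A B (T : probe_tree n sigma A)
    (f : A -> probe_tree n sigma B) s :
  run (bind T f) s = run (f (run T s)) s.
Proof. by elim: T => //= i k IHk; apply: IHk. Qed.

Lemma probes_bind n sigma A B (T : probe_tree n sigma A)
    (f : A -> probe_tree n sigma B) s :
  probes (bind T f) s = probes T s + probes (f (run T s)) s.
Proof. by elim: T => //= i k IHk; rewrite addSn -IHk. Qed.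

(* The [j]th query may use the answer [d] of the previous one; all answers are
   kept in the result, starting from the conventional answer 0. *)
Fixpoint chain (n sigma : nat) (U : nat -> nat -> probe_tree n sigma nat)
    (k : nat) : probe_tree n sigma (seq nat) :=
  if k is k'.+1 then
    bind (chain U k')
      (fun l => bind (U k' (last 0 l)) (fun d => Answer _ _ (rcons l d)))
  else Answer _ _ [:: 0].

(** [U j] is only assumed correct on the true previous value [D j], which the induction finds at the
    end of the list. *)
Lemma run_chain n sigma (U : nat -> nat -> probe_tree n sigma nat) s D k :
  D 0 = 0 -> (forall j, j < k -> run (U j (D j)) s = D j.+1) ->
  run (chain U k) s = mkseq D k.+1.
Proof.
move=> D0; elim: k => [|k IHk] runU; first by rewrite /mkseq /= D0.
rewrite /= !run_bind /= IHk; last by move=> j jk; apply: runU; apply: ltnW.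
by rewrite !mkseqS last_rcons runU.
Qed.

Lemma probes_chain n sigma (U : nat -> nat -> probe_tree n sigma nat) s D k t :
  D 0 = 0 ->
  (forall j, j < k -> run (U j (D j)) s = D j.+1 /\ probes (U j (D j)) s <= t) ->
  probes (chain U k) s <= k * t.
Proof.
move=> D0; elim: k => [//|k IHk] U_ok.
have U_run j : j < k -> run (U j (D j)) s = D j.+1.
  by move=> jk; case: (U_ok j (ltnW jk)).
rewrite /= !probes_bind /= (run_chain D0 U_run) mkseqS last_rcons addn0 mulSn addnC.
apply: leq_add; first by case: (U_ok k (ltnSn k)).
by apply: IHk => j jk; apply: U_ok; apply: ltnW.
Qed.

(** * Counting the inputs compatible with a probe tree *)

(** Once its trace on [P] is fixed, [B] is determined by [B :\: P], a subset of the complement of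
    [P] of known size. *)
Lemma card_trace_le (L : finType) (P Z : {set L}) (k : nat) :
  #|[set B : {set L} | (B :&: P == Z) && (#|B| == k)]| <= 'C(#|~: P|, k - #|Z|).
Proof.
rewrite -cards_draws.
rewrite -(@card_in_imset _ _ (fun B : {set L} => B :\: P)); last first.
  move=> B B'; rewrite !inE => /andP[/eqP BP _] /andP[/eqP B'P _] eqD.
  by rewrite -(setID B P) -(setID B' P) BP B'P eqD.
apply/subset_leq_card/subsetP => C /imsetP[B + ->].
rewrite !inE => /andP[/eqP BP /eqP Bk].
by rewrite cardsD BP Bk eqxx andbT setDE subsetIr.
Qed.

(** The estimate at a leaf: each of at least [h] blocks with [u] or more unprobed positions gains a
    factor [a]; the others get the trivial bound. *)
Lemma prod_bin_le (m L a h u : nat) (P : 'I_m -> {set 'I_L}) (k : 'I_m -> nat) :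
  0 < a -> (forall v l, u <= v -> 'C(v, l) * a <= 2 ^ v) ->
  h <= #|[set j | u <= #|~: P j|]| ->
  (\prod_j 'C(#|~: P j|, k j)) * a ^ h <= 2 ^ \sum_j #|~: P j|.
Proof.
move=> a_gt0 bin_a h_le.
apply: (@leq_trans (\prod_j ('C(#|~: P j|, k j) * (if u <= #|~: P j| then a else 1)))).
  rewrite big_split /= leq_mul2l -big_mkcond /= prod_nat_const.
  by rewrite cardsE in h_le; rewrite leq_pexp2l ?orbT.
rewrite expn_sum; apply: leq_prod => j _.
by case: ifP => [/bin_a//|_]; rewrite muln1 bin_le_expn2.
Qed.

Lemma sum_card_setU1 m L (P : 'I_m -> {set 'I_L}) j o :
  o \notin P j ->
  let P' := fun i => if i == j then o |: P i else P i in
  \sum_i #|P' i| = (\sum_i #|P i|).+1 /\ \sum_i #|~: P i| = (\sum_i #|~: P' i|).+1.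
Proof.
move=> oP P'; have P'j : P' j = o |: P j by rewrite /P' eqxx.
have P'i i : i != j -> P' i = P i by rewrite /P' => /negbTE->.
split; rewrite (bigD1 j) //= [in RHS](bigD1 j) //= P'j.
  by rewrite cardsU1 oP -addSn; congr (_ + _); apply: eq_bigr => i /P'i->.
rewrite -addSn; congr (_ + _); last by apply: eq_bigr => i /P'i->.
have := cardsC (P j); have := cardsC (o |: P j); rewrite cardsU1 oP.
by move: #|P j| #|~: P j| #|~: (o |: P j)| => x y z; lia.
Qed.

(* [P j] collects the positions of block [j] probed on the way to [T]. A probe
   outside [P] splits [Y] in two and halves the bound. *)
Lemma card_tree_le (n sigma m L : nat)
    (enc : blocks m L -> string n sigma) (A : Type)
    (a D : nat) :
  (forall i, (exists c, forall y, access (enc y) i = c) \/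
     (exists j o c0 c1, forall y, access (enc y) i = if o \in y j then c1 else c0)) ->
  (forall (P : 'I_m -> {set 'I_L}) (k : 'I_m -> nat), \sum_j #|P j| <= D ->
     (\prod_j 'C(#|~: P j|, k j)) * a <= 2 ^ \sum_j #|~: P j|) ->
  forall (T : probe_tree n sigma A) (P : 'I_m -> {set 'I_L})
    (Y : {set blocks m L}),
  {in Y &, forall y y' : blocks m L, forall j, y j :&: P j = y' j :&: P j} ->
  {in Y, forall y : blocks m L, probes T (enc y) + \sum_j #|P j| <= D} ->
  {in Y &, forall y y' : blocks m L,
     run T (enc y) = run T (enc y') -> forall j, #|y j| = #|y' j|} ->
  #|Y| * a <= 2 ^ \sum_j #|~: P j|.
Proof.
move=> enc_dep leaf; elim=> [b|i k IHk] P Y YP Yprobes Yrun.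
  have [->|[y0 y0Y]] := set_0Vmem Y; first by rewrite cards0.
  have {}Yprobes := Yprobes _ y0Y; rewrite /= add0n in Yprobes.
  apply: leq_trans (leaf P (fun j => #|y0 j| - #|y0 j :&: P j|) Yprobes).
  rewrite leq_mul2r; apply/orP; right.
  (* All members of [Y] share the answer at this leaf, hence the block sizes of [y0], and by [YP]
     also its traces. *)
  pose F j := [set B : {set 'I_L} | (B :&: P j == y0 j :&: P j) && (#|B| == #|y0 j|)].
  apply: (@leq_trans
    #|(family (fun j => mem (F j)) : simpl_pred (blocks m L))|).
    apply/subset_leq_card/subsetP => y yY; apply/familyP => j.
    by rewrite !inE (YP y y0) // (Yrun y y0) // !eqxx.
  rewrite card_family foldrE big_map big_enum /=.
  by apply: leq_prod => j _; apply: card_trace_le.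
have [[c encc]|[j [o [c0 [c1 encc]]]]] := enc_dep i.
  apply: (IHk c P Y YP) => [y yY|y y' yY y'Y].
    by apply: leq_trans (Yprobes y yY); rewrite /= encc leq_add2r.
  by have := Yrun y y' yY y'Y; rewrite /= !encc.
(* The probe just spent pays for one more element in the sets [P'], so the budget [D] is kept. *)
have branch (c : bool) P' : let Y' := [set y in Y | (o \in y j) == c] in
    {in Y' &, forall y y' : blocks m L, forall j, y j :&: P' j = y' j :&: P' j} ->
    \sum_j #|P' j| <= (\sum_j #|P j|).+1 ->
    #|Y'| * a <= 2 ^ \sum_j #|~: P' j|.
  move=> Y' Y'P' P'le.
  have Y'E y : y \in Y' -> y \in Y /\ access (enc y) i = if c then c1 else c0.
    by rewrite inE => /andP[yY /eqP oc]; rewrite encc oc.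
  apply: (IHk (if c then c1 else c0) P' Y' Y'P') => [y|y y'].
    move=> /Y'E[yY e]; apply: leq_trans (Yprobes y yY).
    by rewrite /= e addSnnS leq_add2l.
  move=> /Y'E[yY e] /Y'E[y'Y e'].
  by have := Yrun y y' yY y'Y; rewrite /= e e'.
have YE : #|Y| = #|[set y in Y | (o \in y j) == true]| +
    #|[set y in Y | (o \in y j) == false]|.
  rewrite -(cardsID [set y : blocks m L | o \in y j] Y).
  congr (_ + _); apply: eq_card => y.
    by rewrite !inE eqb_id.
  by rewrite !inE eqbF_neg andbC.
(* A repeated probe has a known result: all of [Y] follows one branch and [P] stays. *)
have [oP|oP] := boolP (o \in P j).
  have [->|[y0 y0Y]] := set_0Vmem Y; first by rewrite cards0.
  have -> : Y = [set y in Y | (o \in y j) == (o \in y0 j)].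
    apply/setP => y; rewrite inE; case yY: (y \in Y) => //=; apply/esym/eqP.
    by have /setP/(_ o) := YP y y0 yY y0Y j; rewrite !inE oP !andbT.
  apply: branch => // y y'; rewrite !inE => /andP[yY _] /andP[y'Y _].
  exact: YP.
pose P' i := if i == j then o |: P i else P i.
have [sumP sumPC] : \sum_i #|P' i| = (\sum_i #|P i|).+1
    /\ \sum_i #|~: P i| = (\sum_i #|~: P' i|).+1 := sum_card_setU1 oP.
have branch' c : #|[set y in Y | (o \in y j) == c]| * a <= 2 ^ \sum_j #|~: P' j|.
  apply: branch; last by rewrite sumP.
  move=> y y'; rewrite !inE => /andP[yY /eqP yo] /andP[y'Y /eqP y'o] j'.
  rewrite /P'; case: eqP => [->|_]; last exact: YP.
  rewrite !setIUr (YP y y') //; congr (_ :|: _); apply/setP => x; rewrite !inE.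
  by case: eqP => [->|]; rewrite ?andbF ?yo ?y'o.
by rewrite YE sumPC expnS mulnDl mul2n -addnn leq_add.
Qed.

(** * Strings made of padded blocks *)

(* [y j] is the set of free positions of block [j] that hold the letter [c0]. *)
Definition marked (m L W : nat) (y : blocks m L) (i : nat) : bool :=
  [exists p : 'I_m * 'I_L, (i == p.1 * W + p.2) && (p.2 \in y p.1)].

Definition pad_string (n sigma m L W : nat) (c0 c1 : 'I_sigma) (y : blocks m L) :
    string n sigma :=
  [tuple if marked W y i then c0 else c1 | i < n].

Definition marks_before (m L : nat) (y : blocks m L) (j : nat) : nat :=
  \sum_(i < m | i < j) #|y i|.

Lemma access_pad_string n sigma m L W (c0 c1 : 'I_sigma) (y : blocks m L) i :
  access (pad_string n W c0 c1 y) i = if marked W y i then c0 else c1.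
Proof. by rewrite /access tnth_mktuple. Qed.

Lemma block_pos_inj (m L W : nat) (p q : 'I_m * 'I_L) :
  L <= W -> p.1 * W + p.2 = q.1 * W + q.2 -> p = q.
Proof.
move=> LW e; have [p2 q2] := (leq_trans (ltn_ord p.2) LW, leq_trans (ltn_ord q.2) LW).
have := edivn_eq p.1 p2; rewrite e edivn_eq // => -[e1 e2].
by case: p q e1 e2 {e p2 q2} => [p1 p2] [q1 q2] /= e1 e2; congr (_, _); apply: val_inj.
Qed.

Lemma marked_block (m L W : nat) (y : blocks m L) (p : 'I_m * 'I_L) :
  L <= W -> marked W y (p.1 * W + p.2) = (p.2 \in y p.1).
Proof.
move=> LW; apply/existsP/idP => [[q /andP[/eqP e]]|yp]; last by exists p; rewrite eqxx.
by rewrite (block_pos_inj LW e).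
Qed.

Lemma marked_pad (m L W : nat) (y : blocks m L) j i :
  L <= W -> j * W + L <= i < j.+1 * W -> marked W y i = false.
Proof.
move=> LW /andP[lo hi]; apply/existsP => -[[p o] /andP[/eqP /= e _]].
have oL := ltn_ord o.
case: (leqP p j) => pj.
  have : p * W <= j * W by rewrite leq_mul2r pj orbT.
  lia.
have : j.+1 * W <= p * W by rewrite leq_mul2r pj orbT.
lia.
Qed.

(** Provides the first hypothesis of [card_tree_le]: a position is either free in a single block or
    always holds [c1]. *)
Lemma pad_string_dep (n sigma m L W : nat) (c0 c1 : 'I_sigma) (i : 'I_n) :
  L <= W ->
  let enc (y : blocks m L) := pad_string n W c0 c1 y in
  (exists c, forall y, access (enc y) i = c) \/
  (exists j o c0 c1, forall y : blocks m L,
     access (enc y) i = if o \in y j then c1 else c0).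
Proof.
move=> LW enc.
case: (pickP (fun p : 'I_m * 'I_L => val i == p.1 * W + p.2)) => [p /eqP e|no_p].
  right; exists p.1, p.2, c1, c0 => y.
  by rewrite access_pad_string e marked_block.
left; exists c1 => y; rewrite access_pad_string.
by case: (boolP (marked W y i)) => // /existsP[p /andP[e _]]; have := no_p p; rewrite e.
Qed.

Lemma rank_pad_string_sum (n sigma m L W : nat) (c0 c1 : 'I_sigma) (y : blocks m L) N :
  c0 != c1 -> N <= n ->
  rank (pad_string n W c0 c1 y) (c1, N) + \sum_(i < N) marked W y i = N.
Proof.
move=> c01 Nn; rewrite /rank /= -sum1_count big_mkcond (big_nth c1) /=.
rewrite size_takel; last by rewrite size_map size_enum_ord.
rewrite big_mkord -big_split /=.
rewrite -[RHS]card_ord -sum1_card; apply: eq_bigr => i _.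
have i_n : i < n := leq_trans (ltn_ord i) Nn.
rewrite nth_take // (nth_map (Ordinal i_n)) ?size_enum_ord // nth_enum_ord //.
by case: (marked W y i); rewrite ?eqxx // (negbTE c01).
Qed.

(** Double counting: distinct pairs of block and offset sit at distinct positions. *)
Lemma sum_marked (m L W N : nat) (y : blocks m L) :
  L <= W ->
  \sum_(i < N) marked W y i =
  \sum_(p : 'I_m * 'I_L | p.2 \in y p.1) (p.1 * W + p.2 < N).
Proof.
move=> LW.
transitivity (\sum_(i < N) \sum_(p : 'I_m * 'I_L | p.2 \in y p.1) (val i == p.1 * W + p.2)).
  apply: eq_bigr => i _; case: (boolP (marked W y i));
    [move=> /existsP[p /andP[/eqP e yp]]|move=> /existsPn no_p].
    rewrite (bigD1 p) //= e eqxx big1 // => q /andP[_ qp].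
    by apply/eqP; rewrite eqb0; apply: contra qp => /eqP/(block_pos_inj LW)->.
  by rewrite big1 // => p yp; have := no_p p; rewrite yp andbT => /negbTE->.
rewrite exchange_big; apply: eq_bigr => p _.
case: (ltnP (p.1 * W + p.2) N) => pN.
  by rewrite (bigD1 (Ordinal pN)) //= eqxx big1 // => i /negbTE; rewrite -val_eqE /= => ->.
by rewrite big1 // => i _; apply/eqP; rewrite eqb0 neq_ltn (leq_trans (ltn_ord i)).
Qed.

(** A cut at [N] has the free positions of blocks up to [j] before it and those of later blocks
    after it. *)
Lemma rank_pad_string (n sigma m L W : nat) (c0 c1 : 'I_sigma) (y : blocks m L) j N :
  c0 != c1 -> L <= W -> N <= n -> j * W + L <= N <= j.+1 * W ->
  rank (pad_string n W c0 c1 y) (c1, N) + marks_before y j.+1 = N.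
Proof.
move=> c01 LW Nn /andP[lo hi]; rewrite -[RHS](rank_pad_string_sum W y c01 Nn).
congr (_ + _); rewrite sum_marked // /marks_before.
rewrite (eq_bigr (fun p : 'I_m * 'I_L => if p.1 < j.+1 then 1 else 0)); last first.
  move=> [p o] _ /=; have oL := ltn_ord o; case: (ltnP p j.+1) => pj.
    have : p * W <= j * W by rewrite leq_mul2r -ltnS pj orbT.
    by move=> ?; apply/eqP; rewrite eqb1; lia.
  have : j.+1 * W <= p * W by rewrite leq_mul2r pj orbT.
  by move=> ?; apply/eqP; rewrite eqb0 -leqNgt; lia.
rewrite -(pair_big_dep xpredT (fun i o => o \in y i) (fun i o => if i < j.+1 then 1 else 0)) /=.
rewrite big_mkcond; apply: eq_bigr => i _.
by case: ifP => _; rewrite ?sum1_card // big1.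
Qed.

(** * Block sizes recovered from queries *)

Lemma select_rank n sigma (s : string n sigma) (p : 'I_n) c :
  access s p = c -> select s (c, (rank s (c, val p)).+1) = Posz p.
Proof.
move=> sp; rewrite /select /occurrences /=.
have enum_cat : enum 'I_n = take p (enum 'I_n) ++ p :: drop p.+1 (enum 'I_n).
  rewrite -{1}(cat_take_drop p (enum 'I_n)) (drop_nth p) ?size_enum_ord //.
  by rewrite nth_ord_enum.
have -> : rank s (c, val p) = size [seq i <- take p (enum 'I_n) | access s i == c].
  rewrite size_filter /rank /=.
  have {1}-> : s = [seq access s i | i <- enum 'I_n] :> seq _ by rewrite -[LHS](map_tnth_enum s).
  by rewrite -map_take count_map.
move: (take p _) (drop _ _) enum_cat => l l' ->.
by rewrite filter_cat map_cat /= sp eqxx nth_cat size_map ltnn subnn.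
Qed.

Lemma marks_beforeS (m L : nat) (y : blocks m L) (j : 'I_m) :
  marks_before y j.+1 = marks_before y j + #|y j|.
Proof.
rewrite /marks_before (bigD1 j) //= addnC; congr (_ + _); apply: eq_bigl => i.
by rewrite ltnS ltn_neqAle andbC.
Qed.

Lemma marks_before_le (m L : nat) (y : blocks m L) j :
  j <= m -> marks_before y j <= j * L.
Proof.
elim: j => [_|j IHj jm]; first by rewrite /marks_before big_pred0.
rewrite (marks_beforeS y (Ordinal jm)) /= mulSn addnC leq_add //; last exact/IHj/ltnW.
by rewrite (leq_trans (max_card _)) ?card_ord.
Qed.

(* The answer is the position [j * W + v + #|y j|], which lies in the padding
   of block [j] because [v <= #|y j| <= 2 v]. *)
Lemma select_pad_string (n sigma m v W : nat) (c0 c1 : 'I_sigma)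
    (y : blocks m v.*2) (j : 'I_m) :
  c0 != c1 -> v.*2 + v < W -> m * W <= n -> v <= #|y j| ->
  select (pad_string n W c0 c1 y) (c1, (j * W + v - marks_before y j).+1) =
  Posz (j * W + v - marks_before y j + marks_before y j.+1).
Proof.
move=> c01 vW mWn vy.
have yL : #|y j| <= v.*2 by rewrite (leq_trans (max_card _)) ?card_ord.
have jWn : j.+1 * W <= n by apply: leq_trans mWn; rewrite leq_mul2r ltn_ord orbT.
have LW : v.*2 <= W by lia.
(* Keeps the truncated subtraction in the query exact. *)
have Dj : marks_before y j <= j * W.
  by apply: leq_trans (marks_before_le y (ltnW (ltn_ord j))) _; rewrite leq_mul2l LW orbT.
set p := j * W + v - _ + _.
have pE : p = j * W + v + #|y j| by rewrite /p marks_beforeS; lia.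
have pn : p < n by rewrite pE; lia.
have p_pad : j * W + v.*2 <= p < j.+1 * W by rewrite pE; apply/andP; split; lia.
have access_p : access (pad_string n W c0 c1 y) (Ordinal pn) = c1.
  by rewrite access_pad_string (marked_pad y LW p_pad).
rewrite -[RHS](select_rank access_p) /=; congr (select _ (_, _.+1)).
have p_pad' : j * W + v.*2 <= p <= j.+1 * W by case/andP: p_pad => -> /ltnW.
(* Evaluated at [p], this identity shows that the letters [c1] before [p] number
   [j * W + v - marks_before y j]. *)
have := rank_pad_string y c01 LW (ltnW pn) p_pad'.
by rewrite {2}/p => /addIn.
Qed.

(** The rank query ignores the previous count; the select query needs it to aim at the padding. [U]
    depends on [w] because [alg] reads the index. *)
Lemma block_count_queries (n sigma m v W t : nat) (index : string n sigma -> seq bool)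
    (c0 c1 : 'I_sigma) :
  (exists alg, solves_rank index alg t) \/ (exists alg, solves_select index alg t) ->
  c0 != c1 -> v.*2 + v < W -> m * W <= n ->
  let enc (y : blocks m v.*2) := pad_string n W c0 c1 y in
  forall w, exists U : nat -> nat -> probe_tree n sigma nat,
  forall y, index (enc y) = w -> (forall i, v <= #|y i|) ->
  forall j, j < m ->
    run (U j (marks_before y j)) (enc y) = marks_before y j.+1 /\
    probes (U j (marks_before y j)) (enc y) <= t.
Proof.
move=> solved c01 vW mWn enc w.
case: solved => -[alg alg_ok].
  exists (fun j _ => bind (alg w (c1, j.+1 * W)) (fun r => Answer _ _ (j.+1 * W - r))).
  move=> y yw _ j jm; rewrite run_bind probes_bind /= addn0 -yw.
  have jWn : j.+1 * W <= n by apply: leq_trans mWn; rewrite leq_mul2r jm orbT.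
  have [-> probes_le] := alg_ok (enc y) (c1, j.+1 * W) jWn; split=> //.
  have LW : v.*2 <= W by lia.
  have jW : j * W + v.*2 <= j.+1 * W <= j.+1 * W by rewrite leqnn andbT mulSn addnC leq_add2r.
  by rewrite -[X in X - _](rank_pad_string y c01 LW jWn jW) addKn.
exists (fun j d => bind (alg w (c1, (j * W + v - d).+1))
  (fun p => Answer _ _ (`|p|%N - (j * W + v - d)))).
move=> y yw y_heavy j jm; rewrite run_bind probes_bind /= addn0 -yw.
have [-> probes_le] := alg_ok (enc y) (c1, (j * W + v - marks_before y j).+1) isT; split=> //.
by rewrite (select_pad_string (j := Ordinal jm) c01) //= addKn.
Qed.

(** * From counting to redundancy *)

(* Complementation shows that at least half of all subsets of a block of size
   [2 v] have at least [v] elements. *)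
Lemma expn2_le_card_heavy (m v : nat) :
  2 ^ (m * v.*2) <= #|[set y : blocks m v.*2 | [forall j, v <= #|y j|]]| * 2 ^ m.
Proof.
have half : 2 ^ v.*2 <= #|[set B : {set 'I_v.*2} | v <= #|B|]| * 2.
  set H := [set B | _].
  have -> : 2 ^ v.*2 = #|H| + #|~: H|.
    by rewrite cardsC -cardsT -powersetT card_powerset cardsT card_ord.
  rewrite mulnS muln1 leq_add2l -(card_imset (mem (~: H)) (@setC_inj _)).
  apply/subset_leq_card/subsetP => B' /imsetP[B + ->]; rewrite !inE -ltnNge => Bv.
  by have := cardsC B; rewrite card_ord; lia.
apply: (@leq_trans
  (#|(family (fun=> mem [set B : {set 'I_v.*2} | v <= #|B|]) :
        simpl_pred (blocks m v.*2))| * 2 ^ m)).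
  rewrite card_family foldrE big_map big_enum /= prod_nat_const card_ord.
  by rewrite -expnMn [m * _]mulnC expnM; case: (m) => // m'; rewrite leq_exp2r.
rewrite leq_mul2r; apply/orP; right; apply/subset_leq_card/subsetP => y /familyP y_heavy.
by rewrite inE; apply/forallP => j; have := y_heavy j; rewrite inE.
Qed.

(** Padding with [false] to length [r] loses the length, so it is stored too; this gives
    [r.+1 * 2 ^ r] codes. *)
Definition bits_code (r : nat) (w : seq bool) : 'I_r.+1 * r.-tuple bool :=
  (inord (size w), [tuple nth false w i | i < r]).

Lemma bits_code_inj (r : nat) (w w' : seq bool) :
  size w <= r -> size w' <= r -> bits_code r w = bits_code r w' -> w = w'.
Proof.
move=> wr w'r eq_code; have /(congr1 val) := congr1 fst eq_code.
rewrite /= !inordK ?ltnS // => eq_size.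
apply: (@eq_from_nth _ false) => // i iw.
have ir : i < r := leq_trans iw wr.
by have := congr1 (fun c => tnth c.2 (Ordinal ir)) eq_code; rewrite !tnth_mktuple.
Qed.

Lemma card_fibers (T C : finType) (f : T -> C) (X : {set T}) :
  #|X| = \sum_c #|[set x in X | f x == c]|.
Proof.
rewrite -sum1_card (partition_big f predT) //=; apply: eq_bigr => c _.
by rewrite -sum1_card; apply: eq_bigl => x; rewrite inE.
Qed.

(** At least [2 ^ (m * v.*2) / 2 ^ m] inputs are heavy, they split into at most [4 ^ r] fibers of
    [code], and each fiber has at most [2 ^ (m * v.*2) / a ^ h] members. *)
Lemma redundancy_ge (n sigma m v W t a h u : nat) (index : string n sigma -> seq bool) :
  1 < sigma ->
  (exists alg, solves_rank index alg t) \/ (exists alg, solves_select index alg t) ->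
  v.*2 + v < W -> m * W <= n ->
  0 < a -> (forall N l, u <= N -> 'C(N, l) * a <= 2 ^ N) ->
  (forall P : 'I_m -> {set 'I_v.*2}, \sum_j #|P j| <= m * t ->
     h <= #|[set j | u <= #|~: P j|]|) ->
  a ^ h <= 2 ^ ((redundancy index).*2 + m).
Proof.
move=> sigma_gt1 solved vW mWn a_gt0 bin_a good.
pose c0 : 'I_sigma := Ordinal (ltnW sigma_gt1); pose c1 : 'I_sigma := Ordinal sigma_gt1.
have c01 : c0 != c1 by [].
pose enc (y : blocks m v.*2) := pad_string n W c0 c1 y.
set r := redundancy index.
have size_index s : size (index s) <= r by apply: (leq_bigmax s).
pose X := [set y : blocks m v.*2 | [forall j, v <= #|y j|]].
pose code y := bits_code r (index (enc y)).
have fiber_le c : #|[set y in X | code y == c]| * a ^ h <= 2 ^ (m * v.*2).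
  have [->|[y0]] := set_0Vmem [set y in X | code y == c]; first by rewrite cards0.
  rewrite inE => /andP[_ /eqP y0c].
  (* The index is constant on a fiber, so one tree, built from the index of [y0], serves all its
     members. *)
  have [U U_ok] := block_count_queries solved c01 vW mWn (index (enc y0)).
  have {}U_ok (y : blocks m v.*2) : y \in [set y in X | code y == c] -> forall j, j < m ->
      run (U j (marks_before y j)) (enc y) = marks_before y j.+1 /\
      probes (U j (marks_before y j)) (enc y) <= t.
    rewrite !inE => /andP[/forallP y_heavy /eqP yc]; apply: U_ok => //.
    apply: (@bits_code_inj r) => //; exact: etrans yc (esym y0c).
  have before0 (y : blocks m v.*2) : marks_before y 0 = 0 by rewrite /marks_before big_pred0.
  have run_U (y : blocks m v.*2) : y \in [set y in X | code y == c] ->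
      run (chain U m) (enc y) = mkseq (marks_before y) m.+1.
    by move=> /U_ok yU; apply: run_chain => // j /yU[].
  have -> : m * v.*2 = \sum_(j < m) #|~: (set0 : {set 'I_v.*2})|.
    by rewrite setC0 cardsT sum_nat_const !card_ord.
  apply: (@card_tree_le n sigma m v.*2 enc _ (a ^ h) (m * t) _ _ (chain U m) (fun=> set0)).
  - by move=> i; apply: pad_string_dep; lia.
  - by move=> P k /good; apply: prod_bin_le.
  - by move=> y y' _ _ j; rewrite !setI0.
  - move=> y /U_ok yU; rewrite big1 ?addn0; last by move=> j _; rewrite cards0.
    exact: probes_chain (before0 y) yU.
  move=> y y' yY y'Y; rewrite !run_U // => eq_seq j.
  have eqD i : i <= m -> marks_before y i = marks_before y' i.
    by move=> im; have := congr1 (fun l => nth 0 l i) eq_seq; rewrite !nth_mkseq.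
  (* Block sizes are differences of consecutive counts. *)
  have := marks_beforeS y j; rewrite eqD // marks_beforeS eqD 1?ltnW //.
  by move/addnI.
have X_le : #|X| * a ^ h <= 2 ^ r.*2 * 2 ^ (m * v.*2).
  rewrite (card_fibers code) big_distrl /=.
  apply: (@leq_trans (\sum_(c : 'I_r.+1 * r.-tuple bool) 2 ^ (m * v.*2))); first exact: leq_sum.
  rewrite sum_nat_const card_prod card_ord card_tuple card_bool.
  by rewrite leq_mul2r -[r.*2]addnn expnD leq_mul2r ltn_expl ?orbT.
rewrite -(leq_pmul2l (expn_gt0 2 (m * v.*2))).
apply: leq_trans (leq_mul (expn2_le_card_heavy m v) (leqnn _)) _.
rewrite -mulnA [2 ^ m * _]mulnC mulnA.
apply: leq_trans (leq_mul X_le (leqnn _)) _.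
by rewrite expnD mulnA [2 ^ (m * _) * _]mulnC.
Qed.

(** * Choice of the parameters *)

(** Markov's inequality: at most half of the blocks receive more than twice the average budget
    [t]. *)
Lemma card_light_blocks (m L t : nat) (P : 'I_m -> {set 'I_L}) :
  0 < t -> \sum_j #|P j| <= m * t -> m <= #|[set j | #|P j| <= t.*2]|.*2.
Proof.
move=> t_gt0 P_le; have cardG := cardsC [set j | #|P j| <= t.*2].
rewrite card_ord in cardG.
suff : #|~: [set j | #|P j| <= t.*2]|.*2 <= m by lia.
rewrite -(leq_pmul2r t_gt0) -doubleMl doubleMr; apply: leq_trans P_le.
rewrite -sum_nat_const [leqRHS](bigID (mem (~: [set j | #|P j| <= t.*2]))) /=.
apply: leq_trans (leq_addr _ _); apply: leq_sum => j.
by rewrite !inE -ltnNge => /ltnW.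
Qed.

Lemma redundancy_ge_many_blocks (n sigma t : nat) (index : string n sigma -> seq bool) :
  1 < sigma -> 1 < t -> 100 * t <= n ->
  (exists alg, solves_rank index alg t) \/ (exists alg, solves_select index alg t) ->
  exists2 e, t <= 4 ^ e & e * n <= 800 * t * redundancy index.
Proof.
move=> sigma_gt1 t_gt1 tn solved.
have /andP[] := up_log_bounds (isT : 1 < 4) t_gt1.
have := up_log_gt0 4 t; rewrite t_gt1 /=; case: (up_log 4 t) => // e _ e_lt t_le.
exists e.+1 => //; pose m := n %/ (100 * t); set r := redundancy index.
have W_gt0 : 0 < 100 * t by lia.
have mWn : m * (100 * t) <= n by apply: leq_trunc_div.
have m_gt0 : 0 < m by rewrite divn_gt0.
have n_lt : n <= m * (200 * t).
  apply: leq_trans (ltnW (ltn_ceil n W_gt0)) _; rewrite -/m.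
  have -> : m * (200 * t) = 2 * m * (100 * t) by lia.
  by rewrite leq_mul2r; apply/orP; right; lia.
have pow_gt0 : 0 < 2 ^ e.+3 by rewrite expn_gt0.
(* With [v = 33 t] a block has [66 t] free positions; at most [2 t] probes leave [64 t], more than
   [4 ^ 3 * 4 ^ e]. *)
have good (P : 'I_m -> {set 'I_(33 * t).*2}) : \sum_j #|P j| <= m * t ->
    uphalf m <= #|[set j | 4 ^ e.+3 <= #|~: P j|]|.
  move=> /card_light_blocks-/(_ (ltnW t_gt1)) m_le.
  apply: (@leq_trans #|[set j | #|P j| <= t.*2]|); first by lia.
  apply/subset_leq_card/subsetP => j; rewrite !inE => Pj.
  have := cardsC (P j); rewrite card_ord !expnS /= in e_lt *.
  by move: #|P j| #|~: P j| (4 ^ e) Pj e_lt => x y z; lia.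
have W_ok : (33 * t).*2 + 33 * t < 100 * t by lia.
have := redundancy_ge sigma_gt1 solved W_ok mWn pow_gt0
  (fun N l => @bin_mul_expn2_le e.+3 N l) good.
rewrite -expnM leq_exp2l // -/r => le_r.
(* The gain exponent [e.+3] exceeds [e.+1] by 2, which absorbs the term [m] in [le_r]. *)
have em : e.+1 * m <= 4 * r.
  have := leq_mul (leqnn e.+3) (_ : m <= (uphalf m).*2); nia.
by apply: leq_trans (leq_mul (leqnn e.+1) n_lt) _; nia.
Qed.

Lemma redundancy_ge_one_block (n sigma t : nat) (index : string n sigma -> seq bool) :
  1 < sigma -> 200 <= n -> 2 * t <= n ->
  (exists alg, solves_rank index alg t) \/ (exists alg, solves_select index alg t) ->
  n <= 4 ^ (6 * redundancy index).
Proof.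
move=> sigma_gt1 n_ge tn solved; set r := redundancy index.
pose v := n.-1 %/ 3.
have v_lt : 3 * v < n by rewrite /v; lia.
have n_le : n <= 3 * v + 3 by rewrite /v; lia.
(* The number of free positions that surely stay unprobed, about [n / 6] at least. *)
pose x := v.*2 - t.
have x_gt0 : 0 < x by rewrite /x; lia.
have /andP[] := trunc_log_bounds (isT : 1 < 4) x_gt0.
set e := trunc_log 4 x => e_le e_gt.
have pow_gt0 : 0 < 2 ^ e by rewrite expn_gt0.
have good (P : 'I_1 -> {set 'I_v.*2}) : \sum_j #|P j| <= 1 * t ->
    1 <= #|[set j | 4 ^ e <= #|~: P j|]|.
  rewrite big_ord1 mul1n => P_le; apply/card_gt0P; exists ord0; rewrite inE.
  have := cardsC (P ord0); rewrite card_ord /x in e_le *.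
  by move: #|P ord0| #|~: P ord0| (4 ^ e) P_le e_le => a b c; lia.
have W_ok : v.*2 + v < n by lia.
have := redundancy_ge sigma_gt1 solved W_ok (eq_leq (mul1n n)) pow_gt0
  (fun N l => @bin_mul_expn2_le e N l) good.
rewrite expn1 leq_exp2l // -/r => le_r.
have x_ge : 6 * x + 12 >= n by rewrite /x; lia.
(* With [le_r] this forces [0 < r], whence [e + 3 <= 2 r + 4 <= 6 r]. *)
have e_gt1 : 1 < e.
  rewrite ltnNge; apply/negP => e_le1.
  have : 4 ^ e.+1 <= 4 ^ 2 by rewrite leq_exp2l.
  by lia.
apply: (@leq_trans (4 ^ e.+3)); first by rewrite !expnS in e_gt *; lia.
by rewrite leq_exp2l //; lia.
Qed.

(** The integer [e] replaces the logarithm of [t] to base 4, so that the whole bound lives in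
    [nat]. *)
Lemma redundancy_ge_log (n sigma t : nat) (index : string n sigma -> seq bool) :
  1 < sigma -> 200 <= n -> 0 < t -> 2 * t <= n ->
  (exists alg, solves_rank index alg t) \/ (exists alg, solves_select index alg t) ->
  exists2 e, t <= 4 ^ e & e * n <= 800 * t * redundancy index.
Proof.
move=> sigma_gt1 n_ge t_gt0 tn solved.
case: (ltngtP 1 t) => [t_gt1||<-]; [|lia|by exists 0].
case: (leqP (100 * t) n) => [many|few]; first exact: redundancy_ge_many_blocks.
have n_le := redundancy_ge_one_block sigma_gt1 n_ge tn solved.
(* As [n < 100 t], the product [e * n] is at most [600 t r]. *)
exists (6 * redundancy index); first by apply: leq_trans n_le; lia.
apply: leq_trans (leq_mul (leqnn _) (ltnW few)) _.
by rewrite mulnAC mulnA leq_mul2r; apply/orP; right; lia.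
Qed.

(** * The bound over the reals *)

Local Open Scope ring_scope.

Theorem theorem6 (R : realType) :
  exists (C : R) (n0 : nat), 0 < C /\
    forall (n sigma t : nat) (index : string n sigma -> seq bool),
      (n0 <= n)%N -> (2 <= sigma)%N -> (sigma <= n)%N ->
      (1 <= t)%N -> (2 * t <= n)%N ->
      ((exists alg : seq bool -> 'I_sigma * nat -> probe_tree n sigma nat,
          solves_rank index alg t) \/
       (exists alg : seq bool -> 'I_sigma * nat -> probe_tree n sigma int,
          solves_select index alg t)) ->
      C * (n%:R * log2 t%:R / t%:R) <= (redundancy index)%:R.
Proof.
(* 1600 is 800 times the factor 2 in [log_le]; 200 is the threshold of the one-block case. *)
exists 1600%:R^-1, 200%N; split; first by rewrite invr_gt0 ltr0n.
move=> n sigma t index n_ge sigma_gt1 _ t_gt0 tn solved.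
have [e t_le en] := redundancy_ge_log sigma_gt1 n_ge t_gt0 tn solved.
have t_pos : (0 : R) < t%:R by rewrite ltr0n.
have ln2_gt0 : (0 : R) < ln 2 by rewrite ln_gt0 // ltr1n.
have log_le : log2 (t%:R : R) <= 2 * e%:R.
  rewrite /log2 ler_pdivrMr //.
  have -> : 2 * e%:R * ln 2 = ln ((4 ^ e)%:R : R).
    by rewrite -[4%N]/(2 ^ 2)%N -expnM natrX lnXn // -[RHS]mulr_natl natrM.
  by rewrite ler_ln ?posrE ?ltr0n ?expn_gt0 // ler_nat.
rewrite mulrC ler_pdivrMr // ler_pdivrMr //.
apply: le_trans (_ : n%:R * (2 * e%:R) <= _); first by rewrite ler_wpM2l.
by rewrite -!natrM ler_nat; lia.
Qed.
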